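(* Let $n\ge 2$. The CFC elements in type $B_n$ are exactly those having reduced expressions in which each generator occurs at most once. Moreover, $B_n^{CFC}(q)=A_n^{CFC}(q)$.
   Context: $B_n$ is the finite Coxeter group with generators $t,s_1,\dots,s_{n-1}$ whose Coxeter diagram is the path $t-s_1-\cdots-s_{n-1}$, with $m_{ts_1}=4$ and $m=3$ on all other edges. $A_n$ is the finite Coxeter group with $n$ generators whose diagram is a path with all edges $m=3$. For a Coxeter group $W$ with length $\ell$, an element is fully commutative (FC) if any two of its reduced expressions are related by a sequence of transpositions of adjacent commuting generators. A cyclic shift of a word $s_{i_1}\cdots s_{i_k}$ is any word $s_{i_j}\cdots s_{i_k}s_{i_1}\cdots s_{i_{j-1}}$. An element is cyclically fully commutative (CFC) if every cyclic shift of every one of its reduced expressions is a reduced expression of an FC element. $W^{CFC}$ is the set of CFC elements, and $W^{CFC}(q)=\sum_{w\in W^{CFC}}q^{\ell(w)}$. *)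

(* Defs.v *)
From Stdlib Require Import Relations.
From mathcomp Require Import all_boot all_order all_algebra all_fingroup.
From mathcomp Require Import boolp.

Set Implicit Arguments.
Unset Strict Implicit.
Unset Printing Implicit Defensive.

Local Open Scope group_scope.

(* A finite Coxeter system with Coxeter matrix m: the finite group presented by
   the generators cox_gen i and the relations (cox_gen i * cox_gen j) ^+ m i j = 1
   (so m i i = 1 makes cox_gen i an involution).  The presentation is expressed
   by its universal property among all groups, finite or not. *)
Record coxeterSystem (I : finType) (m : I -> I -> nat) := CoxeterSystem {
  cox_group :> finGroupType;
  cox_gen : I -> cox_group;
  cox_rel : forall i j, (cox_gen i * cox_gen j) ^+ m i j = 1;
  cox_span : <<[set cox_gen i | i : I]>> = [set: cox_group];
  cox_univ : forall (H : groupType) (f : I -> H),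
    (forall i j, (f i * f j) ^+ m i j = 1) ->
    exists phi : {multiplicative cox_group -> H}, forall i, phi (cox_gen i) = f i
}.

(* In the path diagrams below, node 0 : 'I_n is the generator t in type B and
   node i > 0 is s_i. *)
Definition adjacent n (i j : 'I_n) : bool := (i.+1 == j) || (j.+1 == i).

Definition coxA_mx n (i j : 'I_n) : nat :=
  if i == j then 1%N else if adjacent i j then 3 else 2.

Definition coxB_mx n (i j : 'I_n) : nat :=
  if i == j then 1%N
  else if adjacent i j then (if minn i j == 0%N then 4 else 3)
  else 2.

Definition coxeterA n := coxeterSystem (@coxA_mx n).
Definition coxeterB n := coxeterSystem (@coxB_mx n).

Definition word_val (I : finType) (m : I -> I -> nat) (W : coxeterSystem m)
  (u : seq I) : W := \prod_(i <- u) cox_gen W i.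

Lemma word_val_surj (I : finType) (m : I -> I -> nat) (W : coxeterSystem m)
  (w : W) : exists k, [exists u : k.-tuple I, word_val W u == w].
Proof.
have: w \in <<[set cox_gen W i | i : I]>> by rewrite cox_span inE.
case/gen_prodgP=> k [c c_gen ->].
have /fin_all_exists [g gP] : forall i, exists j, c i = cox_gen W j.
  by move=> i; have /imsetP[j _ ->] := c_gen i; exists j.
pose u := [seq g i | i <- index_enum 'I_k].
exists (size u); apply/existsP; exists (in_tuple u).
by rewrite /word_val /= big_map; apply/eqP/eq_bigr=> i _; rewrite gP.
Qed.

Definition cox_length (I : finType) (m : I -> I -> nat) (W : coxeterSystem m)
  (w : W) : nat := ex_minn (word_val_surj w).

Definition reduced_expr (I : finType) (m : I -> I -> nat) (W : coxeterSystem m)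
  (w : W) (u : seq I) : Prop := word_val W u = w /\ size u = cox_length w.

Inductive comm_step (I : finType) (m : I -> I -> nat) (W : coxeterSystem m) :
  seq I -> seq I -> Prop :=
| CommStep u i j v : commute (cox_gen W i) (cox_gen W j) ->
    comm_step W (u ++ [:: i, j & v]) (u ++ [:: j, i & v]).

Definition FC (I : finType) (m : I -> I -> nat) (W : coxeterSystem m)
  (w : W) : Prop :=
  forall u v, reduced_expr w u -> reduced_expr w v ->
    clos_refl_trans (seq I) (comm_step W) u v.

Definition CFC (I : finType) (m : I -> I -> nat) (W : coxeterSystem m)
  (w : W) : Prop :=
  forall u k, reduced_expr w u ->
    exists2 x : W, FC x & reduced_expr x (rot k u).

Definition CFC_gf (I : finType) (m : I -> I -> nat) (W : coxeterSystem m) :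
  {poly int} := (\sum_(w : W | `[< CFC w >]) 'X^(cox_length w))%R.

(* Main.v *)
Require Import Defs.
From mathcomp Require Import all_boot all_order all_algebra all_fingroup.
From mathcomp Require Import boolp zify.
From Stdlib Require Import Relations.

(** Both types have the same diagram up to the label of its first edge, and the
    proof treats them together, over any matrix [m] satisfying [linear_mx m].

    Letters of CFC elements are distinct ([CFC_uniq]).  In a reduced word of a
    fully commutative element, two consecutive letters [i] enclose at least two
    neighbours of [i], or a single one joined to [i] by the label 4; moreover
    commutations cannot gather a factor [t s_1 t s_1] or [s_1 t s_1 t].  From
    this, two letters [i > 0] always enclose an [i - 1], since otherwise they
    enclose two letters [i + 1], which enclose two letters [i + 2], and so on
    beyond the end of the path.  In a cyclic word, all of whose rotations have
    these properties, a repeated letter therefore makes all lower letters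
    repeated, down to [t].  When [t] is repeated, two letters [i] also enclose an
    [i + 1], so that every letter is repeated and the last node must have a
    successor, a contradiction ([cyclic_uniq]).

    Conversely, let [u] be a word with distinct letters.  The symmetric group
    and the group of signed permutations are quotients of the Coxeter groups of
    types A and B, by the universal property, and the permutation defined by [u]
    already determines which letters occur in [u] and in which order adjacent
    letters occur ([word_act_support] and [word_act_projection]).  Hence [u] is
    reduced and every reduced word of the same element is a permutation of [u]
    with adjacent letters in the same order; such a word is obtained from [u] by
    commutations ([projections_comm]).  So the element is fully commutative, and
    the same applies to all rotations of its reduced words.

    Thus CFC elements correspond to words with distinct letters up to
    commutations of nonadjacent letters, and lengths to numbers of letters.
    This description depends on the unlabelled path only, whence the equality of
    the generating functions ([CFC_gf_linear]). *)

Set Implicit Arguments.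
Unset Strict Implicit.
Unset Printing Implicit Defensive.

(** * Coxeter matrices of linear diagrams *)

(** The common setting of the two types: a label larger than 3 is allowed on the
    first edge alone, which is the only feature of type B that matters for the
    combinatorics of fully commutative words. *)
Definition linear_mx n (m : 'I_n -> 'I_n -> nat) : Prop :=
  [/\ forall i j, m i j = m j i, forall i, m i i = 1,
      forall i j, i != j -> ~~ adjacent i j -> m i j = 2
    & forall i j, adjacent i j -> m i j = 3 \/ m i j = 4 /\ minn i j = 0].

Lemma adjacent_sym n (i j : 'I_n) : adjacent i j = adjacent j i.
Proof. by rewrite /adjacent orbC. Qed.

Lemma linear_coxA n : linear_mx (@coxA_mx n).
Proof.
rewrite /coxA_mx; split=> [i j|i|i j|i j].
- by rewrite eq_sym adjacent_sym.
- by rewrite eqxx.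
- by move=> /negbTE-> /negbTE->.
by move=> ij; rewrite ij; case: eqP ij => [->|_ _]; [rewrite /adjacent; lia | left].
Qed.

Lemma linear_coxB n : linear_mx (@coxB_mx n).
Proof.
rewrite /coxB_mx; split=> [i j|i|i j|i j].
- by rewrite eq_sym adjacent_sym minnC.
- by rewrite eqxx.
- by move=> /negbTE-> /negbTE->.
move=> ij; rewrite ij; case: eqP ij => [->|_ _]; first by rewrite /adjacent; lia.
by case: eqP => [->|_]; [right | left].
Qed.

(** * Splitting words at occurrences of letters *)

Section Splitting.
Variable T : eqType.
Implicit Types (p : pred T) (u : seq T).

Lemma split_first p u : has p u ->
  exists x a y, [/\ u = x ++ a :: y, p a & ~~ has p x].
Proof.
elim: u => //= b u IH; case: (boolP (p b)) => /= [pb _|pb].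
  by exists [::], b, u.
by case/IH=> x [a [y [-> pa px]]]; exists (b :: x), a, y; rewrite /= (negbTE pb).
Qed.

Lemma split_last p u : has p u ->
  exists x a y, [/\ u = x ++ a :: y, p a & ~~ has p y].
Proof.
rewrite -has_rev => /split_first[x [a [y [def pa px]]]].
exists (rev y), a, (rev x); rewrite has_rev; split=> //.
by rewrite -[u]revK def rev_cat rev_cons cat_rcons.
Qed.

Lemma split_count2 p u : 2 <= count p u ->
  exists x a y b z, [/\ u = x ++ a :: y ++ b :: z, p a & p b].
Proof.
move=> p2; have /split_first[x [a [v [def pa px]]]] : has p u.
  by rewrite has_count (leq_trans _ p2).
have /split_first[y [b [z [defv pb _]]]] : has p v.
  move: p2; rewrite def count_cat /= pa (elimT eqP (_ : count p x == 0)) ?has_count //.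
  by rewrite -leqn0 leqNgt -has_count.
by exists x, a, y, b, z; split; rewrite // def defv.
Qed.

(** Reduces statements on the letters between two occurrences of [i] to the case
    of consecutive occurrences. *)
Lemma shrink_gap u x i y z : u = x ++ i :: y ++ i :: z ->
  exists y1 z1, [/\ u = x ++ i :: y1 ++ i :: z1, i \notin y1 & {subset y1 <= y}].
Proof.
move=> ->; case: (boolP (has (pred1 i) y)) => [|iNy].
  case/split_first=> y1 [_ [y2 [-> /eqP-> iNy1]]].
  exists y1, (y2 ++ i :: z); rewrite -catA -has_pred1; split=> // k ky.
  by rewrite mem_cat ky.
by exists y, z; rewrite -has_pred1; split=> // k.
Qed.

(** Two occurrences of [i] cut the cyclic word [u] into two gaps, each of which
    becomes a gap of a linear word after a suitable rotation; so if every gap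
    has a letter in [p], there are at least two such letters. *)
Lemma rot_count2 p i u :
  (forall k x y z, rot k u = x ++ i :: y ++ i :: z -> has p y) ->
  2 <= count_mem i u -> 2 <= count p u.
Proof.
move=> gap /split_count2[x [a [y [b [z [def /eqP ea /eqP eb]]]]]].
rewrite {}ea {}eb {a b} in def.
have p1 : has p y by apply: (gap 0 x y z); rewrite rot0.
have p2 : has p (z ++ x).
  apply: (gap (size (x ++ i :: y)) [::] _ y); rewrite def.
  rewrite -[in X in rot _ X]cat_cons [x ++ (i :: y) ++ _]catA rot_size_cat.
  by rewrite /= -!catA.
by move: p1 p2; rewrite !has_count def !count_cat /= !count_cat /=; lia.
Qed.

Lemma count1_split p y1 y2 k : p k ->
  count p (y1 ++ k :: y2) = 1 -> ~~ has p y1 /\ ~~ has p y2.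
Proof.
by move=> pk; rewrite !has_count count_cat /= pk; lia.
Qed.

End Splitting.

(** * Cyclic words on a path *)

(** This holds for a reduced word of a fully commutative element.  With no
    neighbour of [i] between two consecutive letters [i], these letters would
    cancel; with a single neighbour [k] and [m i k = 3], the factor [i k i]
    could be turned into [k i k]. *)
Definition sparse n (m : 'I_n -> 'I_n -> nat) (u : seq 'I_n) : Prop :=
  forall x i y z, u = x ++ i :: y ++ i :: z -> i \notin y ->
  2 <= count (adjacent i) y \/
  0 < count (adjacent i) y /\ exists2 k, k \in y & adjacent i k /\ m i k = 4.

(** No factor [a b a b] with [m a b = 4] can be gathered by commutations: in a
    fully commutative element it could be turned into [b a b a]. *)
Definition unbraided n (m : 'I_n -> 'I_n -> nat) (u : seq 'I_n) : Prop :=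
  forall x a y1 b y2 y3 z,
    u = x ++ a :: y1 ++ b :: y2 ++ a :: y3 ++ b :: z -> m a b = 4 ->
    ~~ has (adjacent a) (y1 ++ y2) -> ~~ has (adjacent b) (y2 ++ y3) ->
    a \notin y1 -> b \notin y3 -> False.

Section Combinatorics.
Variables (n : nat) (m : 'I_n -> 'I_n -> nat).
Hypothesis lin : linear_mx m.
Implicit Types (u x y z : seq 'I_n) (i j k : 'I_n).

(** If [j - 1] does not occur between two consecutive letters [j > 0], then
    [sparse] puts two letters [j + 1] there, with no [j] and hence not their
    predecessor between them; the argument then climbs along the path, and it
    stops at the last node, which has no successor. *)
Lemma pred_in_gap u x j y z : sparse m u -> u = x ++ j :: y ++ j :: z ->
  0 < j -> has (fun i : 'I_n => i.+1 == j) y.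
Proof.
move=> sp; have [d] := ubnP (n - j); elim: d => // d IH in x j y z *.
move=> ltd /shrink_gap[y1 [z1 [def jNy1 suby]]] j_gt0.
apply: contraT => noj.
have {suby} noj1 : ~~ has (fun i : 'I_n => i.+1 == j) y1.
  by apply: contra noj => /hasP[k /suby ky kj]; apply/hasP; exists k.
have [|[_ [k ky [adj mjk]]]] := sp _ _ _ _ def jNy1; last first.
  have [_ _ _ /(_ _ _ adj)[|[_ min0]]] := lin; first by rewrite mjk.
  case/negP: noj1; apply/hasP; exists k => //.
  by move: adj; rewrite /adjacent; lia.
rewrite (@eq_in_count _ _ (fun k : 'I_n => k == j.+1 :> nat)) => [|k ky]; last first.
  have: k.+1 != j by apply: contra noj1 => kj; apply/hasP; exists k.
  by rewrite /adjacent => /negbTE->; rewrite orbF eq_sym.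
case/split_count2=> a [k [b [k' [c [defy /eqP kj /eqP k'j]]]]].
have ekk' : k' = k by apply: ord_inj; rewrite k'j.
rewrite {}ekk' {k' k'j} in defy.
have: has (fun i : 'I_n => i.+1 == k) b.
  apply: (IH (x ++ j :: a) k b (c ++ j :: z1)); rewrite ?kj //.
    by have := ltn_ord k; lia.
  by rewrite def defy -?catA /= -?catA.
case/hasP=> i ib; rewrite kj eqSS => /eqP/ord_inj eij.
by rewrite -eij defy mem_cat inE mem_cat ib !orbT in jNy1.
Qed.

(** The only neighbour of the first node is 1, and two letters 1 in the gap
    would enclose a 0. *)
Lemma gap0_count u x y z (t : 'I_n) : sparse m u -> u = x ++ t :: y ++ t :: z ->
  t = 0 :> nat -> t \notin y -> count (adjacent t) y = 1.
Proof.
move=> sp def t0 tNy.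
apply/eqP; rewrite eqn_leq andbC; apply/andP; split.
  by case: (sp _ _ _ _ def tNy) => [/ltnW|[]].
rewrite leqNgt; apply/negP => /split_count2[a [k [b [k' [c [defy ak ak']]]]]].
have k1 : k = 1 :> nat by move: ak; rewrite /adjacent; lia.
have ekk' : k' = k by apply: ord_inj; move: ak'; rewrite /adjacent; lia.
rewrite {}ekk' {k' ak'} in defy.
have: has (fun i : 'I_n => i.+1 == k) b.
  apply: (pred_in_gap (x := x ++ t :: a) (z := c ++ t :: z) sp); rewrite ?k1 //.
  by rewrite def defy -?catA /= -?catA.
case/hasP=> i ib ik; have eit : i = t by apply: ord_inj; move: ik; lia.
by rewrite -eit defy mem_cat inE mem_cat ib !orbT in tNy.
Qed.

(** The step where the label 4 matters: [s t s] with no 2 in it is allowed by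
    itself, but another [t] in the word, on either side, extends it to a
    factor [t s t s] or [s t s t] which commutations can gather. *)
Lemma succ_in_gap1 u x y z (s t : 'I_n) : sparse m u -> unbraided m u ->
  t = 0 :> nat -> s = 1 :> nat -> 2 <= count_mem t u -> s \notin y ->
  u = x ++ s :: y ++ s :: z -> has (fun j : 'I_n => j == s.+1 :> nat) y.
Proof.
move=> sp ub t0 s1 tt sNy def; apply: contraT => no2.
have adj_s k : k \in y -> adjacent s k = (k == t).
  move=> ky; have: k != s.+1 :> nat.
    by apply: contra no2 => ks; apply/hasP; exists k.
  by rewrite -val_eqE /adjacent /= eq_sym => /negbTE->; rewrite t0 s1 eqSS.
have ast : adjacent s t by rewrite /adjacent t0 s1.
have ats : adjacent t s by rewrite adjacent_sym.
have tts : t != s by apply/eqP => e; move: t0; rewrite e s1.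
have no2t : ~ 2 <= count (adjacent s) y.
  rewrite (eq_in_count adj_s).
  case/split_count2=> a [t' [b [t'' [c [defy /eqP e1 /eqP e2]]]]].
  rewrite {}e1 {}e2 {t' t''} in defy.
  have defu : u = (x ++ s :: a) ++ t :: b ++ t :: (c ++ s :: z).
    by rewrite def defy -?catA /= -?catA.
  have [b1 [z1 [defu1 tNb1 sub1]]] := shrink_gap defu.
  have := gap0_count sp defu1 t0 tNb1.
  move=> c1; have /hasP[k /sub1 kb] : has (adjacent t) b1 by rewrite has_count c1.
  rewrite /adjacent t0 => /orP[/eqP k1|//].
  have eks : k = s by apply: ord_inj; rewrite s1.
  by rewrite eks in kb; rewrite defy mem_cat inE mem_cat kb !orbT in sNy.
have [//|[c1 [k ky [ask mst]]]] := sp _ _ _ _ def sNy.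
have ekt : k = t by apply/eqP; rewrite -adj_s.
rewrite {}ekt {k ask} in ky mst.
have [y1 [y2 defy]] : exists y1 y2, y = y1 ++ t :: y2.
  by case/splitPr: ky => y1 y2; exists y1, y2.
have [|Nsy1 Nsy2] := count1_split (p := adjacent s) (y1 := y1) (y2 := y2) ast.
  by apply/eqP; rewrite -defy eqn_leq c1 andbT leqNgt; apply/negP.
have /andP[sNy1 sNy2] : (s \notin y1) && (s \notin y2).
  by move: sNy; rewrite defy mem_cat inE !negb_or => /and3P[-> _ ->].
have : 0 < count_mem t x + count_mem t z.
  have: count_mem t y1 = 0 /\ count_mem t y2 = 0.
    split; apply/eqP; rewrite -leqn0 leqNgt -has_count has_pred1.
      by apply: contra Nsy1 => ty; apply/hasP; exists t.
    by apply: contra Nsy2 => ty; apply/hasP; exists t.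
  move: tt; rewrite def defy !count_cat /= !count_cat /= eqxx.
  by rewrite eq_sym (negbTE tts); lia.
rewrite addn_gt0 -!has_count => /orP[].
  (* taking the last t before the gap of s, there is one s between it and the t
     in the gap, so that t s t s can be gathered *)
  case/split_last=> x1 [a [x2 [defx /eqP ea tNx2]]]; rewrite {}ea in defx.
  rewrite has_pred1 in tNx2.
  have tNy1 : t \notin y1 by apply: contra Nsy1 => ty; apply/hasP; exists t.
  have tN : t \notin x2 ++ s :: y1.
    by rewrite mem_cat inE !negb_or tNx2 tts.
  have defu : u = x1 ++ t :: (x2 ++ s :: y1) ++ t :: (y2 ++ s :: z).
    by rewrite def defy defx -?catA /= -?catA.
  have [Ntx2 Nty1] := count1_split ats (gap0_count sp defu t0 tN).
  have defu' : u = x1 ++ t :: x2 ++ s :: y1 ++ t :: y2 ++ s :: z.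
    by rewrite defu -catA.
  exfalso; apply: (ub _ _ _ _ _ _ _ defu') => //; first by have [-> _ _ _] := lin.
    by rewrite has_cat negb_or Ntx2.
  by rewrite has_cat negb_or Nsy1.
(* symmetrically, the first t after the gap gives s t s t *)
case/split_first=> z1 [a [z2 [defz /eqP ea tNz1]]]; rewrite {}ea in defz.
rewrite has_pred1 in tNz1.
have tNy2 : t \notin y2 by apply: contra Nsy2 => ty; apply/hasP; exists t.
have tN : t \notin y2 ++ s :: z1.
  by rewrite mem_cat inE !negb_or tNy2 tts.
have defu : u = (x ++ s :: y1) ++ t :: (y2 ++ s :: z1) ++ t :: z2.
  by rewrite def defy defz -?catA /= -?catA.
have [Nty2 Ntz1] := count1_split ats (gap0_count sp defu t0 tN).
have defu' : u = x ++ s :: y1 ++ t :: y2 ++ s :: z1 ++ t :: z2.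
  by rewrite defu -?catA /= -?catA.
exfalso; apply: (ub _ _ _ _ _ _ _ defu') => //.
  by rewrite has_cat negb_or Nsy1.
by rewrite has_cat negb_or Nty2.
Qed.

(** Once the first node occurs twice, the mirror image of [pred_in_gap] holds,
    by ascending induction on [i] from the cases 0 and 1: a gap of [i > 1] without
    [i + 1] would have two letters [i - 1] in it, hence an [i] between those. *)
Lemma succ_in_gap u (t : 'I_n) : sparse m u -> unbraided m u ->
  t = 0 :> nat -> 2 <= count_mem t u ->
  forall x i y z, u = x ++ i :: y ++ i :: z ->
  has (fun j : 'I_n => j == i.+1 :> nat) y.
Proof.
move=> sp ub t0 tt x i y z.
have [d] := ubnP (nat_of_ord i); elim: d => // d IH in x i y z *.
move=> ltd /shrink_gap[y1 [z1 [def iNy suby]]].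
suff /hasP[j /suby jy ji] : has (fun j : 'I_n => j == i.+1 :> nat) y1.
  by apply/hasP; exists j.
have [i0|i_gt0] := posnP i.
  have := gap0_count sp def i0 iNy => c1.
  have /hasP[k ky] : has (adjacent i) y1 by rewrite has_count c1.
  by rewrite /adjacent i0 orbF eq_sym => k1; apply/hasP; exists k; rewrite ?i0.
have [i1|i_neq1] := eqVneq (i : nat) 1.
  exact: succ_in_gap1 sp ub t0 i1 tt iNy def.
apply: contraT => no.
have adj_i k : k \in y1 -> adjacent i k = (k.+1 == i).
  move=> ky; have: k != i.+1 :> nat.
    by apply: contra no => ki; apply/hasP; exists k.
  by rewrite /adjacent eq_sym => /negbTE->.
have [|[_ [k ky [adj mik]]]] := sp _ _ _ _ def iNy; last first.
  have [_ _ _ /(_ _ _ adj)[|[_ min0]]] := lin; first by rewrite mik.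
  by move: adj; rewrite adj_i //; lia.
rewrite (eq_in_count adj_i).
case/split_count2=> a [k [b [k' [c [defy /eqP ki /eqP ki']]]]].
have ekk' : k' = k by apply: ord_inj; lia.
rewrite {}ekk' {k' ki'} in defy.
have: has (fun j : 'I_n => j == k.+1 :> nat) b.
  apply: (IH (x ++ i :: a) k b (c ++ i :: z1)); first by lia.
  by rewrite def defy -?catA /= -?catA.
case/hasP=> j jb; rewrite ki => /eqP/ord_inj eij.
by rewrite -eij defy mem_cat inE mem_cat jb !orbT in iNy.
Qed.

(** By [pred_in_gap] a repeated letter forces its predecessor to be repeated,
    down to the node 0; by [succ_in_gap] the repetition then propagates upwards
    through all the nodes and past the end of the path. *)
Lemma cyclic_uniq u : (forall k : nat, sparse m (rot k u)) ->
  (forall k : nat, unbraided m (rot k u)) -> uniq u.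
Proof.
move=> sp ub; apply: contraT => Nuniq.
have [i ii] : exists i, 2 <= count_mem i u.
  apply: contrapT => no; case/negP: Nuniq; apply: count_mem_uniq => i.
  have: ~ 2 <= count_mem i u by move=> ii; apply: no; exists i.
  by rewrite -has_pred1 has_count; case: (count_mem i u) => [|[]].
have {i ii} [t t0 tt] : exists2 t : 'I_n, t = 0 :> nat & 2 <= count_mem t u.
  move def_d: (nat_of_ord i) => d; elim: d i ii def_d => [|d IH] i ii di.
    by exists i.
  have c2 : 2 <= count (fun k : 'I_n => k.+1 == i) u.
    apply: rot_count2 ii => k x y z def.
    by apply: (pred_in_gap (sp k) def); rewrite di.
  have /hasP[j _ ji] : has (fun k : 'I_n => k.+1 == i) u.
    by rewrite has_count (leq_trans _ c2).
  apply: (IH j); last by lia.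
  rewrite (leq_trans c2) // -(@eq_count _ (fun k : 'I_n => k.+1 == i)) // => k.
  by rewrite /= -val_eqE /= -(eqP ji) eqSS.
have {t0 tt} all2 d : exists2 i : 'I_n, i = d :> nat & 2 <= count_mem i u.
  elim: d => [|d [i id ii]]; first by exists t.
  have c2 : 2 <= count (fun k : 'I_n => k == i.+1 :> nat) u.
    apply: rot_count2 ii => k x y z def.
    apply: (succ_in_gap (sp k) (ub k) t0 _ def).
    by have /seq.permP-> : perm_eq (rot k u) u by rewrite perm_rot.
  have /hasP[j _ ji] : has (fun k : 'I_n => k == i.+1 :> nat) u.
    by rewrite has_count (leq_trans _ c2).
  exists j; first by rewrite (eqP ji) id.
  rewrite (leq_trans c2) // -(@eq_count _ (fun k : 'I_n => k == i.+1 :> nat)) // => k.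
  by rewrite /= -val_eqE /= (eqP ji).
by have [i] := all2 n; have := ltn_ord i; lia.
Qed.

End Combinatorics.

(** * Reduced words of fully commutative elements *)

Section CoxeterWords.
Local Open Scope group_scope.
Variables (n : nat) (m : 'I_n -> 'I_n -> nat).
Hypothesis lin : linear_mx m.
Variable W : coxeterSystem m.
Implicit Types (u v x y z : seq 'I_n) (w : W) (i j k a b : 'I_n).
Local Notation g := (cox_gen W).

Lemma word_val_cons i u : word_val W (i :: u) = g i * word_val W u.
Proof. by rewrite /word_val big_cons. Qed.

Lemma word_val_cat u v : word_val W (u ++ v) = word_val W u * word_val W v.
Proof. by rewrite /word_val big_cat. Qed.

Lemma word_val_nil : word_val W [::] = 1.
Proof. by rewrite /word_val big_nil. Qed.

Lemma reduced_min w u v :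
  reduced_expr w u -> word_val W v = w -> size u <= size v.
Proof.
case=> _ ->; rewrite /cox_length; case: ex_minnP => l _ minl valv.
by apply: minl; apply/existsP; exists (in_tuple v); rewrite valv.
Qed.

Lemma reduced_exists w : exists u, reduced_expr w u.
Proof.
rewrite /reduced_expr /cox_length; case: ex_minnP => l /existsP[u /eqP valu] _.
by exists u; rewrite size_tuple.
Qed.

Lemma reduced_eq_size w u v : reduced_expr w u -> word_val W v = w ->
  size v = size u -> reduced_expr w v.
Proof. by case=> _ sz valv szv; split; rewrite // szv. Qed.

Lemma genK i : g i * g i = 1.
Proof.
by have := cox_rel W i i; have [_ -> _ _] := lin; rewrite expg1.
Qed.

Lemma genV i : (g i)^-1 = g i.
Proof. by apply/(mulgI (g i)); rewrite mulgV genK. Qed.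

Lemma gen_commute i j : ~~ adjacent i j -> commute (g i) (g j).
Proof.
move=> Nadj; have [-> //|neq] := eqVneq i j.
have := cox_rel W i j; have [_ _ -> // _] := lin; rewrite expg2.
by move/mulg1_eq => e; rewrite /commute -[LHS]e !invMg !genV.
Qed.

Lemma braid3 i j : m i j = 3 -> g i * g j * g i = g j * g i * g j.
Proof.
move=> mij; have := cox_rel W i j; rewrite mij !expgSr expg0 mul1g => e.
have: g i * g j * g i * (g j * g i * g j) = 1 by rewrite -e !mulgA.
by move/mulg1_eq => e'; rewrite -e' !invMg !genV ?mulgA.
Qed.

Lemma braid4 i j : m i j = 4 -> g i * g j * g i * g j = g j * g i * g j * g i.
Proof.
move=> mij; have := cox_rel W i j; rewrite mij !expgSr expg0 mul1g => e.
have: g i * g j * g i * g j * (g i * g j * g i * g j) = 1 by rewrite -e !mulgA.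
by move/mulg1_eq => e'; rewrite -[LHS]e' !invMg !genV ?mulgA.
Qed.

Lemma word_commute i y : ~~ has (adjacent i) y -> commute (g i) (word_val W y).
Proof.
elim: y => [|j y IH] /=; first by rewrite word_val_nil => _; apply: commute1.
rewrite negb_or => /andP[ij iy]; rewrite word_val_cons.
by apply: commuteM; [apply: gen_commute | apply: IH].
Qed.

Lemma comm_step_perm u v : clos_refl_trans _ (comm_step W) u v -> perm_eq u v.
Proof.
elim=> {u v} [_ _ [u i j v _]|u|u v y _ uv _ vy] //; last exact: perm_trans uv vy.
by rewrite perm_cat2l (perm_catCA [:: i] [:: j]).
Qed.

(** Two letters that do not commute never jump over each other. *)
Lemma comm_step_filter a b u v : ~ commute (g a) (g b) ->
  clos_refl_trans _ (comm_step W) u v ->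
  filter (pred2 a b) u = filter (pred2 a b) v.
Proof.
move=> Nab; elim=> {u v} [_ _ [u i j v cij]|u|u v y _ uv _ vy] //; last by rewrite uv.
rewrite !filter_cat /=; congr (_ ++ _).
case: ifP => // ia; case: ifP => // jb.
case/orP: ia cij => /eqP->; case/orP: jb => /eqP-> // cij; case: Nab;
  first [exact: cij | exact: commute_sym].
Qed.

(** The rewritten word is reduced as well, but contains one [i] less; as
    commutations only permute the letters, full commutativity excludes it. *)
Lemma FC_sparse w u : FC w -> reduced_expr w u -> sparse m u.
Proof.
move=> fc red x i y z def iNy.
have valu : word_val W u = w by case: red.
have [c2|c1] := leqP 2 (count (adjacent i) y); [by left | right].
have [/hasP/= [k ky ik]|/word_commute ciy] := boolP (has (adjacent i) y); last first.
  have := reduced_min red (v := x ++ y ++ z); rewrite -valu def.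
  rewrite !size_cat /= size_cat /= => lt; exfalso.
  suff /lt : word_val W (x ++ y ++ z) = word_val W (x ++ i :: y ++ i :: z) by lia.
  rewrite !(word_val_cat, word_val_cons); congr (_ * _).
  by rewrite [RHS]mulgA ciy -mulgA (mulgA (g i)) genK mul1g.
have c_eq1 : count (adjacent i) y = 1%N.
  apply/eqP; rewrite eqn_leq -ltnS c1 -has_count; apply/hasP; by exists k.
split; first by rewrite c_eq1.
exists k => //; split=> //.
have [_ _ _ /(_ _ _ ik)[mik|[]//]] := lin.
have [y1 [y2 defy]] : exists y1 y2, y = y1 ++ k :: y2.
  by case/splitPr: ky => y1 y2; exists y1, y2.
have [Niy1 Niy2] := count1_split (y1 := y1) (y2 := y2) ik (etrans (congr1 _ (esym defy)) c_eq1).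
pose v := x ++ y1 ++ [:: k; i; k] ++ y2 ++ z.
have redv : reduced_expr w v.
  apply: (reduced_eq_size red); last first.
    by rewrite def defy !size_cat /= ?size_cat /= ?size_cat /=; lia.
  rewrite -valu def defy !(word_val_cat, word_val_cons) word_val_nil !mulg1.
  rewrite -!mulgA; congr (_ * _).
  rewrite [RHS]mulgA (word_commute Niy1) -mulgA; congr (_ * _).
  rewrite [X in _ = g i * (g k * X)]mulgA -(word_commute Niy2) -!mulgA.
  rewrite [RHS]mulgA [RHS]mulgA [LHS]mulgA [LHS]mulgA; congr (_ * _).
  by rewrite (braid3 mik).
have /comm_step_perm /seq.permP/(_ (pred1 i)) := fc _ _ red redv.
have ki : k != i by apply: contraNneq iNy => <-.
rewrite def defy !count_cat /= ?count_cat /= ?count_cat /=.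
by rewrite (negbTE ki) eqxx; lia.
Qed.

(** Exchanging [a b a b] for [b a b a] changes the subword on the letters [a] and
    [b], which commutations preserve, unless the generators [a] and [b] commute;
    but in that case [a b a b] is trivial and the word is not reduced. *)
Lemma FC_unbraided w u : FC w -> reduced_expr w u -> unbraided m u.
Proof.
move=> fc red x a y1 b y2 y3 z def mab Na Nb aNy1 bNy3.
have valu : word_val W u = w by case: red.
have adj : adjacent a b.
  apply: contraT => Nadj; have [_ m1 m2 _] := lin.
  by have [eab|/m2/(_ Nadj)] := eqVneq a b; [move: mab; rewrite eab m1 | rewrite mab].
have neq : a != b.
  by apply/eqP => eab; move: mab; rewrite eab; have [_ -> _ _] := lin.
rewrite !has_cat !negb_or in Na Nb.
case/andP: Na Nb => [Nay1 Nay2] /andP[Nby2 Nby3].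
pose core c := x ++ y1 ++ c ++ y2 ++ y3 ++ z.
have valu' : word_val W (core [:: a; b; a; b]) = w.
  rewrite -valu def !(word_val_cat, word_val_cons) word_val_nil !mulg1.
  rewrite -!mulgA; congr (_ * _).
  rewrite [RHS]mulgA (word_commute Nay1) -mulgA; congr (_ * (_ * _)).
  rewrite [X in _ = g b * X]mulgA -(word_commute Nay2) -mulgA.
  rewrite [X in _ = g b * (g a * (_ * X))]mulgA -(word_commute Nby3) -mulgA.
  by rewrite [X in _ = g b * (g a * X)]mulgA -(word_commute Nby2) -mulgA.
have [cab|Ncab] := pselect (commute (g a) (g b)).
  have := reduced_min red (v := core [::]); rewrite def /core.
  rewrite !size_cat /= ?size_cat /= ?size_cat /= ?size_cat /=.
  suff -> : word_val W (x ++ y1 ++ y2 ++ y3 ++ z) = w by move/(_ erefl); lia.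
  rewrite -valu' /core !(word_val_cat, word_val_cons) word_val_nil !mulg1.
  congr (_ * (_ * _)).
  suff -> : g a * (g b * (g a * g b)) = 1 by rewrite mul1g.
  by rewrite cab [X in g a * X]mulgA genK mul1g genK.
have redv : reduced_expr w (core [:: b; a; b; a]).
  apply: (reduced_eq_size red); last first.
    by rewrite def /core !size_cat /= ?size_cat /= ?size_cat /= ?size_cat /=; lia.
  rewrite -valu' /core !(word_val_cat, word_val_cons) word_val_nil !mulg1.
  by congr (_ * (_ * (_ * _))); rewrite !mulgA (braid4 mab).
have no_ab y : a \notin y -> b \notin y -> filter (pred2 a b) y = [::].
  move=> ay Nby; apply/eqP; rewrite -[_ == _]negbK -has_filter.
  apply/hasPn => k ky /=; apply/norP.
  by split; [apply: contraNneq ay => <- | apply: contraNneq Nby => <-].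
have bNy1 : b \notin y1 by apply: contra Nay1 => ky; apply/hasP; exists b.
have bNy2 : b \notin y2 by apply: contra Nay2 => ky; apply/hasP; exists b.
have aNy2 : a \notin y2.
  by apply: contra Nby2 => ky; apply/hasP; exists a; rewrite // adjacent_sym.
have aNy3 : a \notin y3.
  by apply: contra Nby3 => ky; apply/hasP; exists a; rewrite // adjacent_sym.
have := comm_step_filter Ncab (fc _ _ red redv).
rewrite def /core !filter_cat /= eqxx /= filter_cat /= eqxx orbT /=.
rewrite filter_cat /= eqxx /= filter_cat /= eqxx orbT.
rewrite (no_ab y1) ?(no_ab y2) ?(no_ab y3) //= => /eqP.
rewrite eqseq_cat //= => /andP[_ /eqP[eab]].
by rewrite eab eqxx in neq.
Qed.

Lemma CFC_uniq w u : CFC w -> reduced_expr w u -> uniq u.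
Proof.
move=> cfc red; apply: (cyclic_uniq lin) => k; have [x fc redx] := cfc u k red.
  exact: FC_sparse fc redx.
exact: FC_unbraided fc redx.
Qed.

End CoxeterWords.

(** * Trace equivalence and projections on pairs of letters *)

Lemma comm_step_val n (m : 'I_n -> 'I_n -> nat) (W : coxeterSystem m) u v :
  clos_refl_trans _ (comm_step W) u v -> word_val W u = word_val W v.
Proof.
elim=> {u v} [_ _ [u i j v cij]|//|u v y _ -> _ //].
rewrite !(word_val_cat, word_val_cons); congr (_ * _)%g.
by rewrite !mulgA cij.
Qed.

Section Projection.
Variables (n : nat) (m : 'I_n -> 'I_n -> nat).
Hypothesis lin : linear_mx m.
Variable W : coxeterSystem m.
Implicit Types (u v x y z : seq 'I_n) (i j k : 'I_n).

Let comm := clos_refl_trans (seq 'I_n) (comm_step W).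

Lemma comm_cons i u v : comm u v -> comm (i :: u) (i :: v).
Proof.
elim=> [_ _ [x j k y cjk]|x|x y z _ xy _ yz].
- by apply: rt_step; rewrite -!cat_cons; apply: CommStep.
- exact: rt_refl.
- exact: rt_trans xy yz.
Qed.

Lemma comm_past i x y : ~~ has (adjacent i) x ->
  comm (i :: x ++ y) (x ++ i :: y).
Proof.
elim: x => [|j x IH] /= => [_|]; first exact: rt_refl.
rewrite negb_or => /andP[ij ix].
apply: rt_trans (comm_cons j (IH ix)); apply: rt_step.
by apply: (@CommStep _ _ W [::]); apply: (gen_commute lin).
Qed.

(** Projection criterion for trace equivalence.  The first letter [i] of [u] can
    be moved to the front of [v]: a letter adjacent to [i] that precedes it in
    [v] would also precede it in [u]. *)
Lemma projections_comm u v : perm_eq u v ->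
  (forall i j, adjacent i j -> filter (pred2 i j) u = filter (pred2 i j) v) ->
  comm u v.
Proof.
elim: u v => [|i u IH] v perm_uv proj.
  by move: perm_uv; rewrite perm_sym => /perm_nilP->; apply: rt_refl.
have /split_first[x [a [y [def /eqP ea iNx]]]] : has (pred1 i) v.
  by rewrite has_pred1 -(perm_mem perm_uv) mem_head.
rewrite {}ea {a} in def; rewrite has_pred1 in iNx; rewrite {v}def in perm_uv proj *.
have Nix : ~~ has (adjacent i) x.
  apply/hasPn => j jx; apply/negP => ij.
  have := proj i j ij; rewrite filter_cat /= eqxx /=.
  have: has (pred2 i j) x by apply/hasP; exists j; rewrite //= eqxx orbT.
  rewrite has_filter; case def: (filter _ x) => [|k s] //= _ [eik _].
  case/negP: iNx; have: k \in k :: s by [exact: mem_head].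
  by rewrite -def mem_filter -eik => /andP[].
apply: rt_trans (comm_past y Nix); apply: comm_cons; apply: IH.
  rewrite -(perm_cons i); apply: perm_trans perm_uv _.
  by rewrite -cat1s perm_catCA.
move=> j k jk; have := proj j k jk; rewrite !filter_cat /=.
case: ifP => // ijk; suff -> : filter (pred2 j k) x = [::] by case.
apply/eqP; rewrite -[_ == _]negbK -has_filter; apply/hasPn => l lx /=.
apply/negP => ljk.
have [eli|nli] := eqVneq l i; first by rewrite -eli lx in iNx.
case/hasP: Nix; exists l => //.
case/orP: ijk => /eqP eij; case/orP: ljk => /eqP elk; subst => //.
  by rewrite eqxx in nli.
  by rewrite adjacent_sym.
by rewrite eqxx in nli.
Qed.

End Projection.

(** * Permutation models *)

Section PathActionDef.
Local Open Scope group_scope.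

(** A permutation model of the Coxeter group in which the support of a word with
    distinct letters, and the order of its adjacent letters, can be read off.
    The side of [i] is invariant under all generators but [i], so that a point
    can leave it only by means of the letter [i].  Let [j] be the successor of
    [i].  The letter [i] by itself does not take any point of its side out of
    the union of the sides of [i] and [j], but the point [pa_exit i] that it
    reaches waits there for [j], the only other letter that can move it, and [j]
    takes it out of this union.  Thus leaving the union requires [i] to act
    before [j]. *)
Record path_action n (m : 'I_n -> 'I_n -> nat) := PathAction {
  pa_point : finType;
  pa_act : 'I_n -> {perm pa_point};
  pa_side : 'I_n -> {set pa_point};
  pa_exit : 'I_n -> pa_point;
  pa_rel : forall i j, (pa_act i * pa_act j) ^+ m i j = 1;
  pa_stable : forall (i j : 'I_n) p, i != j ->
    (pa_act j p \in pa_side i) = (p \in pa_side i);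
  pa_cross : forall i, exists2 p, p \in pa_side i & pa_act i p = pa_exit i;
  pa_exit_side : forall i, pa_exit i \notin pa_side i;
  pa_exit_fix : forall i k : 'I_n, k != i -> k != i.+1 :> nat ->
    pa_act k (pa_exit i) = pa_exit i;
  pa_exit_next : forall i j : 'I_n, j = i.+1 :> nat ->
    pa_act j (pa_exit i) \notin pa_side i :|: pa_side j;
  pa_side_next : forall (i j : 'I_n) p, j = i.+1 :> nat -> p \in pa_side i ->
    pa_act i p \in pa_side i :|: pa_side j
}.

End PathActionDef.

Section PathAction.
Local Open Scope group_scope.
Variables (n : nat) (m : 'I_n -> 'I_n -> nat) (P : path_action m).
Implicit Types (u v x y z : seq 'I_n) (i j k : 'I_n).
Local Notation f := (pa_act P).
Local Notation S := (pa_side P).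
Local Notation q := (pa_exit P).

Definition word_act u : {perm pa_point P} := \prod_(i <- u) f i.

Lemma word_act_val (W : coxeterSystem m) u v :
  word_val W u = word_val W v -> word_act u = word_act v.
Proof.
have [phi phiE] := cox_univ W (pa_rel P).
have phiM : {morph phi : a b / a * b} by exact: gmulfM.
have phi1 : phi 1 = 1 by apply: (mulgI (phi 1)); rewrite -phiM !mulg1.
have actE x : word_act x = phi (word_val W x).
  rewrite /word_val (big_morph phi phiM phi1).
  by apply: eq_bigr => i _; rewrite phiE.
by rewrite !actE => ->.
Qed.

Lemma word_act_cat u v p : word_act (u ++ v) p = word_act v (word_act u p).
Proof. by rewrite /word_act big_cat permM. Qed.

Lemma word_act_cons i u p : word_act (i :: u) p = word_act u (f i p).
Proof. by rewrite /word_act big_cons permM. Qed.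

Lemma word_act_stable i u p : i \notin u -> (word_act u p \in S i) = (p \in S i).
Proof.
elim: u p => [|j u IH] p; first by rewrite /word_act big_nil perm1.
by rewrite inE negb_or word_act_cons => /andP[ij /IH->]; apply: pa_stable.
Qed.

Lemma word_act_arrive i x : i \notin x ->
  exists2 p, p \in S i & f i (word_act x p) = q i.
Proof.
move=> iNx; have [p pS fp] := pa_cross P i.
by exists ((word_act x)^-1 p); [rewrite -(word_act_stable _ iNx) permKV | rewrite permKV].
Qed.

Lemma word_act_exit i x y : i \notin x -> i \notin y ->
  exists2 p, p \in S i & word_act (x ++ i :: y) p \notin S i.
Proof.
move=> iNx iNy; have [p pS fp] := word_act_arrive iNx; exists p => //.
by rewrite word_act_cat word_act_cons fp word_act_stable ?pa_exit_side.
Qed.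

Lemma word_act_fix i j y : j = i.+1 :> nat -> i \notin y -> j \notin y ->
  word_act y (q i) = q i.
Proof.
move=> ji; elim: y => [|k y IH]; first by rewrite /word_act big_nil perm1.
rewrite !inE !negb_or word_act_cons => /andP[ik iy] /andP[jk jy].
by rewrite (@pa_exit_fix _ _ _ i k) ?IH // -?ji ?val_eqE eq_sym.
Qed.

Lemma word_act_stableU i j z p : i \notin z -> j \notin z ->
  (word_act z p \in S i :|: S j) = (p \in S i :|: S j).
Proof. by move=> iz jz; rewrite !in_setU !word_act_stable. Qed.

(** With [word_act_after], this recovers the order of two adjacent letters from
    the permutation: a point of the side of [i] can get out of both sides only
    if [i] acts before [j]. *)
Lemma word_act_before i j x y z : j = i.+1 :> nat ->
  i \notin x -> i \notin y -> j \notin y -> i \notin z -> j \notin z ->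
  exists2 p, p \in S i & word_act (x ++ i :: y ++ j :: z) p \notin S i :|: S j.
Proof.
move=> ji ix iy jy iz jz; have [p pS fp] := word_act_arrive ix; exists p => //.
rewrite word_act_cat word_act_cons fp word_act_cat word_act_cons.
by rewrite (word_act_fix ji) // word_act_stableU // pa_exit_next.
Qed.

Lemma word_act_after i j x z p : j = i.+1 :> nat ->
  i \notin x -> i \notin z -> j \notin z ->
  p \in S i -> word_act (x ++ i :: z) p \in S i :|: S j.
Proof.
move=> ji ix iz jz pS; rewrite word_act_cat word_act_cons word_act_stableU //.
by rewrite pa_side_next // word_act_stable.
Qed.

(** A letter occurring once carries a point across its side, which a word without
    this letter cannot do. *)
Lemma word_act_support u v : uniq u -> word_act u = word_act v -> {subset u <= v}.
Proof.
move=> uu uv i iu; apply: contraT => iv; move: uu uv.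
case/splitPr: iu => x y; rewrite uniq_catC /= mem_cat negb_or => /andP[/andP[iy ix] _] uv.
have [p pS] := word_act_exit ix iy.
by rewrite uv word_act_stable // pS.
Qed.

Lemma uniq_pair i j u : uniq u -> i \in u -> j \in u -> i != j ->
  exists x y z, [/\ i \notin x ++ y ++ z, j \notin x ++ y ++ z
    & u = x ++ i :: y ++ j :: z \/ u = x ++ j :: y ++ i :: z].
Proof.
move=> + iu; case/splitPr: iu => x y; rewrite mem_cat inE => uu + ij.
case/or3P=> [jx|/eqP eji|jy]; last 1 first.
- case/splitPr: jy uu => y1 y2 uu; exists x, y1, y2.
  suff /andP[iN jN] : (i \notin x ++ y1 ++ y2) && (j \notin x ++ y1 ++ y2).
    by split=> //; left.
  move: uu; rewrite (perm_uniq (_ : perm_eq _ (i :: j :: x ++ y1 ++ y2))) /=.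
    by rewrite inE negb_or => /and3P[/andP[_ ->] ->].
  by apply/seq.permP => p; rewrite !count_cat /= !count_cat /=; lia.
- case/splitPr: jx uu => x1 x2; rewrite -catA cat_cons => uu; exists x1, x2, y.
  suff /andP[iN jN] : (i \notin x1 ++ x2 ++ y) && (j \notin x1 ++ x2 ++ y).
    by split=> //; right.
  move: uu; rewrite (perm_uniq (_ : perm_eq _ (j :: i :: x1 ++ x2 ++ y))) /=.
    by rewrite inE negb_or => /and3P[/andP[_ ->] ->].
  by apply/seq.permP => p; rewrite !count_cat /= !count_cat /=; lia.
by rewrite eji eqxx in ij.
Qed.

(** When both letters occur in [u] and [v], their order is determined by
    [word_act_before] and [word_act_after]; otherwise the projections have at
    most one letter. *)
Lemma word_act_projection u v i j : uniq u -> perm_eq u v ->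
  word_act u = word_act v -> adjacent i j ->
  filter (pred2 i j) u = filter (pred2 i j) v.
Proof.
move=> uu puv euv; wlog ji : i j / j = i.+1 :> nat => [IH adj|_].
  have pred2C k l x : filter (pred2 k l) x = filter (pred2 l k) x.
    by apply: eq_filter => a /=; rewrite orbC.
  case/orP: (adj) => /eqP e; first exact: IH.
  by rewrite !(pred2C i); apply: IH; rewrite // adjacent_sym.
have uv : uniq v by rewrite -(perm_uniq puv).
have ij : i != j by rewrite -val_eqE /= ji; lia.
have small : ~~ ((i \in v) && (j \in v)) ->
    filter (pred2 i j) u = filter (pred2 i j) v.
  move=> Nij; apply: perm_small_eq (perm_filter _ puv).
  have szl k l : k \notin v -> size (filter (pred2 k l) v) <= 1.
    move=> kv; apply: (@uniq_leq_size _ _ [:: l]); first exact: filter_uniq.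
    move=> a; rewrite mem_filter inE /= => /andP[/orP[/eqP->|//]].
    by rewrite (negbTE kv).
  case/nandP: Nij => [/szl//|/(szl j i)].
  by rewrite (eq_filter (a2 := pred2 i j)) // => a /=; rewrite orbC.
case: (boolP ((i \in v) && (j \in v))) => [/andP[iv jv]|/small//].
have iu : i \in u by rewrite (perm_mem puv).
have ju : j \in u by rewrite (perm_mem puv).
have filt2 x y z k l : (k == i) || (k == j) -> (l == i) || (l == j) ->
    i \notin x ++ y ++ z -> j \notin x ++ y ++ z ->
    filter (pred2 i j) (x ++ k :: y ++ l :: z) = [:: k; l].
  move=> kij lij iN jN; have: filter (pred2 i j) (x ++ y ++ z) = [::].
    apply/eqP; rewrite -[_ == _]negbK -has_filter; apply/hasPn => a aN /=.
    by apply/norP; split; [apply: contraNneq iN => <- | apply: contraNneq jN => <-].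
  rewrite !filter_cat /= kij filter_cat /= lij.
  by do 3!case: (filter _ _) => //=.
have opposite x y z x' y' z' : i \notin x ++ y ++ z -> j \notin x ++ y ++ z ->
    i \notin x' ++ y' ++ z' -> j \notin x' ++ y' ++ z' ->
    word_act (x ++ i :: y ++ j :: z) = word_act (x' ++ j :: y' ++ i :: z') -> False.
  rewrite !mem_cat !negb_or => /and3P[ix iy iz] /and3P[jx jy jz].
  move=> /and3P[ix' iy' iz'] /and3P[jx' jy' jz'] e.
  have [p pS] := word_act_before ji ix iy jy iz jz.
  rewrite e -cat_cons catA word_act_after //.
  by rewrite mem_cat inE !negb_or ix' ij.
have [x [y [z [iN jN defu]]]] := uniq_pair uu iu ju ij.
have [x' [y' [z' [iN' jN' defv]]]] := uniq_pair uv iv jv ij.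
case: defu defv euv => -> [] -> euv; rewrite !filt2 //= ?eqxx ?orbT //.
  by case: (opposite _ _ _ _ _ _ iN jN iN' jN' euv).
by case: (opposite _ _ _ _ _ _ iN' jN' iN jN (esym euv)).
Qed.

End PathAction.

Section GroupLemmas.
Local Open Scope group_scope.

(** The relation of [j] and [i] is the inverse of that of [i] and [j], so it is
    enough to check the generators in increasing order. *)
Lemma linear_rel n (m : 'I_n -> 'I_n -> nat) (G : groupType) (f : 'I_n -> G) :
  linear_mx m -> (forall i, f i * f i = 1) ->
  (forall i j : 'I_n, i.+1 < j -> commute (f i) (f j)) ->
  (forall i j : 'I_n, j = i.+1 :> nat -> (f i * f j) ^+ m i j = 1) ->
  forall i j, (f i * f j) ^+ m i j = 1.
Proof.
move=> [msym m1 m2 _] ff fC fA.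
have up (i j : 'I_n) : i < j -> (f i * f j) ^+ m i j = 1.
  rewrite leq_eqVlt => /predU1P[/esym/fA//|ij].
  rewrite m2 -?val_eqE /adjacent /=; try lia.
  by rewrite (expgMn _ (fC _ _ ij)) !expg2 !ff mulg1.
move=> i j; have [ij|ji|/ord_inj->] := ltngtP i j; first exact: up.
  have fV k : (f k)^-1 = f k by apply/(mulgI (f k)); rewrite mulgV ff.
  by rewrite msym -[f i * f j]invgK invMg !fV expVgn up ?invg1.
by rewrite m1 ff.
Qed.

Lemma tperm_commute (T : finType) (x y : T) (s : {perm T}) :
  s x = x -> s y = y -> commute (tperm x y) s.
Proof. by move=> sx sy; rewrite /commute conjgC tpermJ sx sy. Qed.

Lemma tperm_braid (T : finType) (x y z : T) : x != y -> y != z -> x != z ->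
  (tperm x y * tperm y z) ^+ 3 = 1.
Proof.
move=> xy yz xz; set a := tperm x y; set b := tperm y z.
have aba : a * b * a = tperm x z.
  rewrite -mulgA -[X in X * _]tpermV -conjgE tpermJ tpermR tpermD //.
have bab : b * a * b = tperm x z.
  rewrite -mulgA -[X in X * _]tpermV -conjgE tpermJ tpermL tpermD //; by rewrite eq_sym.
transitivity ((a * b * a) * (b * a * b)).
  by rewrite !expgSr expg0 mul1g !mulgA.
by rewrite aba bab tperm2.
Qed.

End GroupLemmas.

(** The symmetric group on [0, ..., n], where the generator [i] exchanges [i] and
    [i + 1] and its side is the initial segment [0, ..., i]. *)
Lemma path_action_A n : path_action (@coxA_mx n).
Proof.
pose lo (i : 'I_n) : 'I_n.+1 := widen_ord (leqnSn n) i.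
pose hi (i : 'I_n) : 'I_n.+1 := lift ord0 i.
have hiE i : hi i = i.+1 :> nat by rewrite /= /bump.
pose f i := tperm (lo i) (hi i).
have fE i (p : 'I_n.+1) : f i p = (if p == i :> nat then i.+1 else
    if p == i.+1 :> nat then i : nat else p) :> nat.
  rewrite /f; case: tpermP => [->|->|/eqP + /eqP +]; rewrite ?hiE /= ?eqxx //.
    by case: eqP => // ; lia.
  by rewrite -!val_eqE /= /bump => /negbTE-> /negbTE->.
refine (@PathAction n _ 'I_n.+1 f (fun i => [set p : 'I_n.+1 | p <= i]) hi _ _ _ _ _ _ _).
- apply: linear_rel => [|i|i j ij|i j ji]; first exact: linear_coxA.
  + exact: tperm2.
  + by apply: tperm_commute; apply: ord_inj; rewrite fE ?hiE /=; do 2?case: eqP; lia.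
  have -> : coxA_mx i j = 3.
    by rewrite /coxA_mx /adjacent ji eqxx -val_eqE /= ji; case: eqP => //; lia.
  have -> : f j = tperm (hi i) (hi j).
    by congr tperm; apply: ord_inj; rewrite hiE /= ji.
  by apply: tperm_braid; rewrite -val_eqE /= /bump ?leq0n; lia.
- move=> i j p; rewrite -val_eqE !inE fE /= => ij; do 2?case: eqP; lia.
- move=> i; exists (lo i); first by rewrite inE.
  by rewrite /f tpermL.
- by move=> i; rewrite inE hiE ltnn.
- move=> i k; rewrite -val_eqE /= => ki ki1; apply: ord_inj; rewrite fE hiE.
  do 2?case: eqP; lia.
- by move=> i j ji; rewrite !inE fE hiE; do 2?case: eqP; lia.
move=> i j p ji; rewrite !inE fE => pi; do 2?case: eqP; lia.
Qed.

Section SignedPermutations.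
Local Open Scope group_scope.
Variable T : finType.

Definition lift_fun (s : {perm T}) (p : T * bool) : T * bool := (s p.1, p.2).

Lemma lift_fun_inj s : injective (lift_fun s).
Proof. by move=> [a b] [a' b'] [/perm_inj-> ->]. Qed.

Definition unsigned s : {perm T * bool} := perm (@lift_fun_inj s).
Definition sign_flip (a : T) : {perm T * bool} := tperm (a, true) (a, false).

Lemma unsignedE s p : unsigned s p = (s p.1, p.2).
Proof. by rewrite permE. Qed.

Lemma unsignedM s t : unsigned (s * t) = unsigned s * unsigned t.
Proof. by apply/permP => p; rewrite permM !unsignedE permM. Qed.

Lemma unsigned1 : unsigned 1 = 1.
Proof. by apply/permP => -[a b]; rewrite unsignedE !perm1. Qed.

Lemma unsignedX s k : unsigned (s ^+ k) = unsigned s ^+ k.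
Proof. by elim: k => [|k IH]; rewrite ?expg0 ?unsigned1 // !expgS unsignedM IH. Qed.

Lemma sign_flipJ a s : sign_flip a ^ unsigned s = sign_flip (s a).
Proof. by rewrite /sign_flip tpermJ !unsignedE. Qed.

Lemma sign_flip_commute a b : commute (sign_flip a) (sign_flip b).
Proof.
have [->//|ab] := eqVneq a b.
by apply: tperm_commute; rewrite tpermD // xpair_eqE eq_sym (negbTE ab).
Qed.

(** The square of this product changes the signs of both [a] and [b], whence its
    order 4 when [a] and [b] are distinct. *)
Lemma sign_flip_braid a b : (sign_flip a * unsigned (tperm a b)) ^+ 4 = 1.
Proof.
set s := unsigned _; have ss : s * s = 1 by rewrite -unsignedM tperm2 unsigned1.
have two : (sign_flip a * s) ^+ 2 = sign_flip a * sign_flip b.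
  rewrite expg2 -mulgA; congr (_ * _).
  have -> : sign_flip b = sign_flip a ^ s by rewrite sign_flipJ tpermL.
  by rewrite conjgE (mulg1_eq ss).
by rewrite (expgM _ 2 2) two expgMn ?expg2 ?tperm2 ?mulg1 //; apply: sign_flip_commute.
Qed.

Lemma sign_flip1 a p : (sign_flip a p).1 = p.1.
Proof. by rewrite /sign_flip; case: tpermP => [->|->|]. Qed.

End SignedPermutations.

(** The group of signed permutations of [n] points: the generator 0 changes the
    sign of the point 0, and [i > 0] exchanges the points [i - 1] and [i].  The
    side of 0 is the set of positive points, that of [i > 0] the set of points
    of absolute value less than [i]. *)
Lemma path_action_B n : path_action (@coxB_mx n).
Proof.
pose below (i : 'I_n) : 'I_n := Ordinal (leq_ltn_trans (leq_pred i) (ltn_ord i)).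
pose f (i : 'I_n) :=
  if i == 0%N :> nat then sign_flip i else unsigned (tperm (below i) i).
have f0 (i : 'I_n) : i = 0%N :> nat -> f i = sign_flip i by rewrite /f => ->.
have fS (i : 'I_n) : 0 < i -> f i = unsigned (tperm (below i) i).
  by rewrite /f => i_gt0; rewrite gtn_eqF.
have f1 (i : 'I_n) p : (f i p).1 = (if i == 0%N :> nat then p.1 : nat else
    if p.1 == i.-1 :> nat then i : nat else if p.1 == i :> nat then i.-1 else p.1) :> nat.
  rewrite /f; case: eqP => i0; first by rewrite sign_flip1.
  rewrite unsignedE /=; case: tpermP => [->|->|/eqP + /eqP +] /=; rewrite ?eqxx //.
    case: eqP => [e|_]; rewrite ?eqxx //=; lia.
  by rewrite -!val_eqE /= => /negbTE-> /negbTE->.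
have f2 (i : 'I_n) p : 0 < i -> (f i p).2 = p.2 by move=> /fS->; rewrite unsignedE.
pose S (i : 'I_n) : {set 'I_n * bool} :=
  [set p : 'I_n * bool | if i == 0%N :> nat then p.2 else p.1 < i].
have f0_fix (i : 'I_n) (p : 'I_n * bool) : i = 0%N :> nat -> 0 < p.1 -> f i p = p.
  move=> i0; case: p => k b /= k_gt0; rewrite f0 // /sign_flip tpermD // xpair_eqE -val_eqE /=;
  by rewrite i0 eq_sym gtn_eqF.
refine (@PathAction n _ _ f S (fun i => (i, false)) _ _ _ _ _ _ _).
- apply: linear_rel => [|i|i j ij|i j ji]; first exact: linear_coxB.
  + rewrite /f; case: ifP => _; first exact: tperm2.
    by rewrite -unsignedM tperm2 unsigned1.
  + rewrite (fS j); last by lia.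
    have [i0|i_gt0] := posnP i.
      rewrite f0 //; apply: tperm_commute; rewrite unsignedE /= tpermD // -val_eqE /=; lia.
    rewrite fS // /commute -!unsignedM; congr unsigned.
    by apply: tperm_commute; rewrite tpermD // -val_eqE /=; lia.
  have bji : below j = i by apply: ord_inj; rewrite /= ji.
  have ij : (i == j) = false by rewrite -val_eqE /= ji; lia.
  rewrite (fS j) ?ji // bji /coxB_mx ij /adjacent ji eqxx /=.
  have [i0|i_gt0] := posnP i; first by rewrite i0 min0n eqxx f0 // sign_flip_braid.
  have -> : (minn i i.+1 == 0%N) = false by lia.
  rewrite fS // -unsignedM -unsignedX tperm_braid ?unsigned1 // -val_eqE /=; lia.
- move=> i j p; rewrite -val_eqE !inE /= => ij; case: ifP => i0.
    by rewrite f2 //; lia.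
  rewrite f1; case: eqP => [//|j0]; case: p => k b /=; do 2?case: eqP; lia.
- move=> i; rewrite /S; case: (posnP i) => i0.
    by exists (i, true); rewrite ?inE ?i0 //= f0 // /sign_flip tpermL.
  exists (below i, false); first by rewrite inE /=; lia.
  by rewrite fS // unsignedE /= tpermL.
- by move=> i; rewrite inE /=; case: ifP; rewrite ?ltnn.
- move=> i k; rewrite -val_eqE /= => ki ki1.
  have [k0|k_gt0] := posnP k; first by rewrite f0_fix //=; lia.
  by rewrite fS // unsignedE /= tpermD // -val_eqE /=; lia.
- move=> i j ji; rewrite !inE f1 f2 ?ji //= eqxx /=.
  by do 3?case: eqP; lia.
move=> i j p ji; rewrite !inE; have [i0|i_gt0] := posnP i.
  rewrite ji i0 /= => p2; case: (posnP p.1) => p0; last by rewrite f0_fix ?p2.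
  by rewrite orbC f1 i0 p0.
rewrite ji /= f1 (gtn_eqF i_gt0) => pi; apply/orP; right; case: p pi => k b /=; do 2?case: eqP; lia.
Qed.

(** * Words with distinct letters *)

Section UniqueLetters.
Variables (n : nat) (m : 'I_n -> 'I_n -> nat).
Hypothesis lin : linear_mx m.
Variables (P : path_action m) (W : coxeterSystem m).
Implicit Types (u v : seq 'I_n) (w : W).

(** Any word of the same value contains all the letters of [u]. *)
Lemma uniq_reduced u : uniq u -> reduced_expr (word_val W u) u.
Proof.
move=> uu; have [v red] := reduced_exists (word_val W u).
have [valv _] := red; apply: (reduced_eq_size red) => //.
apply/eqP; rewrite eqn_leq (reduced_min red) // andbT.
by apply: uniq_leq_size (word_act_support uu (word_act_val P (esym valv))).
Qed.

(** A word as short as [u] that contains all its letters has no other letter. *)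
Lemma reduced_uniq_perm u v : uniq u -> reduced_expr (word_val W u) v ->
  perm_eq u v.
Proof.
move=> uu red; have [valv _] := red.
have sub := word_act_support uu (word_act_val P (esym valv)).
have szv : size v <= size u by apply: reduced_min red _.
have [_ uv] := uniq_min_size uu sub szv.
exact: uniq_perm uu (leq_size_uniq uu sub szv) uv.
Qed.

Lemma uniq_projections u v : uniq u -> perm_eq u v ->
  word_val W u = word_val W v -> forall i j, adjacent i j ->
  filter (pred2 i j) u = filter (pred2 i j) v.
Proof.
move=> uu puv /(word_act_val P) euv i j; exact: (word_act_projection uu puv euv).
Qed.

Lemma uniq_FC u : uniq u -> FC (word_val W u).
Proof.
move=> uu a b reda redb.
have ua := reduced_uniq_perm uu reda; have ub := reduced_uniq_perm uu redb.
have pab : perm_eq a b by rewrite perm_sym in ua; apply: perm_trans ua ub.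
have uniqa : uniq a by rewrite -(perm_uniq ua).
apply: (projections_comm lin W pab); apply: uniq_projections => //.
by case: reda => -> _; case: redb.
Qed.

(** For the converse of [CFC_uniq], rotations preserve distinctness of letters,
    and a word with distinct letters is a reduced word of an element that is
    fully commutative. *)
Lemma CFC_uniqP w : CFC w <-> exists u : seq 'I_n, reduced_expr w u /\ uniq u.
Proof.
split=> [cfc|[u [red uu]] v k redv].
  by have [u red] := reduced_exists w; exists u; split; last exact: CFC_uniq red.
have [valu _] := red; rewrite -valu in redv.
have uv : uniq (rot k v) by rewrite rot_uniq -(perm_uniq (reduced_uniq_perm uu redv)).
by exists (word_val W (rot k v)); [apply: uniq_FC | apply: uniq_reduced].
Qed.

Lemma CFC_val w : CFC w -> exists2 u, uniq u & word_val W u = w.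
Proof. by case/CFC_uniqP=> u [[valu _] uu]; exists u. Qed.

Lemma uniq_CFC u : uniq u -> CFC (word_val W u).
Proof. by move=> uu; apply/CFC_uniqP; exists u; split=> //; apply: uniq_reduced. Qed.

Lemma uniq_length u : uniq u -> cox_length (word_val W u) = size u.
Proof. by case/uniq_reduced=> _ ->. Qed.

(** Equality of the values of two words with distinct letters is trace
    equivalence, which depends on the adjacency relation but not on the labels
    of the edges. *)
Lemma uniq_val_transfer m' (lin' : linear_mx m') (W' : coxeterSystem m') u v :
  uniq u -> uniq v -> word_val W u = word_val W v -> word_val W' u = word_val W' v.
Proof.
move=> uu uv euv; apply: comm_step_val.
have puv : perm_eq u v by apply: reduced_uniq_perm; rewrite // euv; apply: uniq_reduced.
by apply: (projections_comm lin' W' puv); apply: uniq_projections.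
Qed.

(** By [uniq_val_transfer] the image does not depend on the word chosen. *)
Lemma uniq_transfer m' (lin' : linear_mx m') (W' : coxeterSystem m') :
  exists h : W -> W', forall u, uniq u -> h (word_val W u) = word_val W' u.
Proof.
have /fin_all_exists[h hE] : forall w : W, exists w' : W',
    forall u, uniq u -> word_val W u = w -> w' = word_val W' u.
  move=> w; have [[u uu valu]|no] := pselect (exists2 u, uniq u & word_val W u = w).
    exists (word_val W' u) => v uv valv; apply: uniq_val_transfer => //.
    by rewrite valu valv.
  by exists 1%g => u uu valu; case: no; exists u.
by exists h => u uu; apply: hE.
Qed.

End UniqueLetters.

(** The maps given by [uniq_transfer] in both directions preserve lengths and are
    inverse to each other on CFC elements. *)
Lemma CFC_gf_linear n (m m' : 'I_n -> 'I_n -> nat) :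
  linear_mx m -> linear_mx m' -> path_action m -> path_action m' ->
  forall (W : coxeterSystem m) (W' : coxeterSystem m'), CFC_gf W = CFC_gf W'.
Proof.
move=> lin lin' P P' W W'.
have [h hE] := uniq_transfer P W lin' W'.
have [h' hE'] := uniq_transfer P' W' lin W.
rewrite /CFC_gf (reindex_onto h' h) /=; last first.
  by move=> w /asboolP/(CFC_val lin P)[u uu <-]; rewrite hE ?hE'.
apply: eq_big => [w'|w' /andP[/asboolP cfc /eqP e]]; last first.
  have [u uu eu] := CFC_val lin P cfc; rewrite -eu (uniq_length P) //.
  by rewrite -e -eu hE // (uniq_length P').
apply/andP/asboolP => [[/asboolP cfc /eqP <-]|cfc].
  by have [u uu <-] := CFC_val lin P cfc; rewrite hE //; apply: (uniq_CFC lin' P').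
have [u uu <-] := CFC_val lin' P' cfc; rewrite hE' // hE // eqxx; split=> //.
exact/asboolP/(uniq_CFC lin P).
Qed.

Theorem corollary3p3 (n : nat) (hn : (2 <= n)%N) (B : coxeterB n) (A : coxeterA n) :
  (forall w : B, CFC w <-> exists u : seq 'I_n, reduced_expr w u /\ uniq u) /\
  CFC_gf B = CFC_gf A.
Proof.
split=> [w|]; first exact: (CFC_uniqP (linear_coxB n) (path_action_B n) w).
exact: (CFC_gf_linear (linear_coxB n) (linear_coxA n) (path_action_B n) (path_action_A n)).
Qed.
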